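(* Let $k$ and $n$ be two nonnegative integers with $n\equiv k \pmod 2$, and let $\theta(n,k)$ be the largest root of the equation $$x^{3}-(n-4)x^{2}-(n+2k-1)x+2(k+1)(n-k-4)=0.$$ Then the following hold. (1) If either $n\geq k+4$ and $n\notin\{k+6,k+8\}$, or $(k,n)=(0,8)$, then $\rho(K_{n-k-3}\vee K_{k+1}\vee(2K_1))=\theta(n,k)$ and the graph $K_{n-k-3}\vee K_{k+1}\vee(2K_1)$ is not $k$-factor-critical. (2) If $n=k+6$, then $\rho(K_{k+2}\vee(4K_1))=\frac{k+1+\sqrt{k^{2}+18k+33}}{2}$ and the graph $K_{k+2}\vee(4K_1)$ is not $k$-factor-critical. (3) If $n=k+8$, then $\rho(K_{k+3}\vee(5K_1))=\frac{k+2+\sqrt{k^{2}+24k+64}}{2}$ and the graph $K_{k+3}\vee(5K_1)$ is not $k$-factor-critical.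
   Context: All graphs are finite and simple (no loops, no multiple edges). The spectral radius $\rho(G)$ is the largest eigenvalue of the (0,1)-adjacency matrix $A(G)$ of $G$. $K_m$ is the complete graph on $m$ vertices, and $mK_1$ is the graph consisting of $m$ isolated vertices. For vertex-disjoint graphs $G_1,\dots,G_r$ ($r\geq2$), the sequential join $G_1\vee G_2\vee\cdots\vee G_r$ is the graph with vertex set $V(G_1)\cup\cdots\cup V(G_r)$ whose edges are all edges of each $G_i$ together with all pairs $uv$ with $u\in V(G_i)$ and $v\in V(G_{i+1})$ for some $1\leq i\leq r-1$. In particular, only consecutive graphs are joined: in $G_1\vee G_2\vee G_3$ there are no edges between $V(G_1)$ and $V(G_3)$. For $Q\subseteq V(G)$, $G-Q$ is the graph obtained from $G$ by removing the vertices in $Q$ and their incident edges. A perfect matching (1-factor) of a graph is a spanning subgraph in which every vertex has degree exactly 1. For a nonnegative integer $k$, a graph $G$ is $k$-factor-critical if $G-Q$ has a perfect matching for every $Q\subseteq V(G)$ with $|Q|=k$. *)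

(* Defs.v *)
From HB Require Import structures.
From mathcomp Require Import all_boot all_order all_algebra.
From mathcomp Require polyrcf.
From mathcomp Require Import ring lra.

Set Implicit Arguments.
Unset Strict Implicit.
Unset Printing Implicit Defensive.

Import Order.TTheory GRing.Theory Num.Theory.
Local Open Scope ring_scope.

Record sgraph := SGraph {
  vertex :> finType;
  edge : rel vertex;
  edge_sym : symmetric edge;
  edge_irrefl : irreflexive edge
}.

Lemma complete_sym m : symmetric (fun i j : 'I_m => i != j).
Proof. by move=> i j; rewrite eq_sym. Qed.

Lemma complete_irrefl m : irreflexive (fun i j : 'I_m => i != j).
Proof. by move=> i; rewrite eqxx. Qed.

Definition complete (m : nat) : sgraph :=
  SGraph (@complete_sym m) (@complete_irrefl m).

Definition edgeless (m : nat) : sgraph :=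
  @SGraph 'I_m (fun _ _ => false) (fun _ _ => erefl) (fun _ => erefl).

Section SequentialJoin.
Variables (r : nat) (G : 'I_r -> sgraph).

(* The vertices are the pairs of an index i and a vertex of the i-th graph.
   When tag u == tag v, tagged_as u v is the second component of v, seen in
   the vertex type of u. *)
Definition seqjoin_vertex : finType := {i : 'I_r & G i}.

Definition seqjoin_edge : rel seqjoin_vertex := fun u v =>
  [|| (tag u == tag v) && edge (tagged u) (tagged_as u v),
      (tag u).+1 == tag v :> nat | (tag v).+1 == tag u :> nat].

Lemma seqjoin_sym : symmetric seqjoin_edge.
Proof.
move=> [i x] [j y]; rewrite /seqjoin_edge /=; congr orb; last exact: orbC.
case: (eqVneq i j) => [ij|_]; last by [].
by case: _ / ij y => y /=; rewrite !tagged_asE edge_sym.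
Qed.

Lemma seqjoin_irrefl : irreflexive seqjoin_edge.
Proof.
move=> [i x]; rewrite /seqjoin_edge /= eqxx tagged_asE edge_irrefl.
by rewrite orbb /= gtn_eqF.
Qed.

Definition seqjoin : sgraph := SGraph seqjoin_sym seqjoin_irrefl.

End SequentialJoin.

Definition seqjoin2 (G1 G2 : sgraph) : sgraph :=
  seqjoin (fun i : 'I_2 => if val i is 0 then G1 else G2).

Definition seqjoin3 (G1 G2 G3 : sgraph) : sgraph :=
  seqjoin (fun i : 'I_3 =>
    match val i with 0 => G1 | 1 => G2 | _ => G3 end).

Section Matchings.
Variable G : sgraph.

Definition remove_edge (Q : {set G}) : rel {x : G | x \notin Q} :=
  fun x y => edge (val x) (val y).

Lemma remove_sym Q : symmetric (@remove_edge Q).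
Proof. by move=> x y; apply: edge_sym. Qed.

Lemma remove_irrefl Q : irreflexive (@remove_edge Q).
Proof. by move=> x; apply: edge_irrefl. Qed.

Definition remove (Q : {set G}) : sgraph :=
  SGraph (@remove_sym Q) (@remove_irrefl Q).

Definition has_perfect_matching : Prop :=
  exists m : rel G,
    [/\ symmetric m, subrel m (@edge G) & forall x, #|[set y | m x y]| = 1%N].

End Matchings.

Definition factor_critical (k : nat) (G : sgraph) : Prop :=
  forall Q : {set G}, #|Q| = k -> has_perfect_matching (remove Q).

Definition is_largest (R : rcfType) (P : pred R) (x : R) : Prop :=
  P x /\ forall y, P y -> y <= x.

Definition adjmx (R : rcfType) (G : sgraph) : 'M[R]_#|G| :=
  \matrix_(i, j) (edge (enum_val i) (enum_val j))%:R.

(* A(G) is symmetric, so all its eigenvalues are real, and nothing is lost by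
   considering only those in R. *)
Definition is_spectral_radius (R : rcfType) (G : sgraph) (rho : R) : Prop :=
  is_largest (eigenvalue (adjmx R G)) rho.

Definition theta_poly (R : rcfType) (n k : nat) : {poly R} :=
  'X^3 - (n%:R - 4) *: 'X^2 - (n%:R + 2 * k%:R - 1) *: 'X
    + (2 * (k%:R + 1) * (n%:R - k%:R - 4))%:P.

Definition is_theta (R : rcfType) (n k : nat) (theta : R) : Prop :=
  is_largest (root (theta_poly R n k)) theta.

Lemma theta_exists (R : rcfType) (n k : nat) :
  exists theta : R, is_theta n k theta.
Proof.
pose p := theta_poly R n k.
pose a : R := n%:R - 4; pose b : R := n%:R + 2 * k%:R - 1.
pose c : R := 2 * (k%:R + 1) * (n%:R - k%:R - 4).
have pE x : p.[x] = x ^+ 3 - a * x ^+ 2 - b * x + c.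
  by rewrite !(hornerE, hornerXn).
have p_neq0 : p != 0.
  apply/eqP => p0; have: p`_3 = 0 by rewrite p0 coef0.
  rewrite /p /theta_poly !(coefD, coefN, coefZ, coefXn, coefX, coefC) /=.
  by rewrite !mulr0 !subr0 addr0 => /eqP; rewrite oner_eq0.
pose M := 1 + `|a| + `|b| + `|c|.
have [a0 b0 c0] := And3 (normr_ge0 a) (normr_ge0 b) (normr_ge0 c).
have M1 : 1 <= M by rewrite /M; lra.
have M2 : M <= M ^+ 2 by nra.
have M_ge : `|a| * M ^+ 2 + `|b| * M + `|c| <= M ^+ 3.
  have -> : M ^+ 3 = M ^+ 2 * (1 + `|a| + `|b| + `|c|) by rewrite /M; ring.
  by nra.
have M0 : 0 <= M by lra.
have M20 : 0 <= M ^+ 2 by exact: sqr_ge0.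
have [x0 _ x0P] : exists2 x, - M <= x <= M & root p x.
  apply: poly_ivt; first by lra.
  have aM1 := ler_wpM2r M20 (ler_norm a).
  have aM2 := ler_wpM2r M20 (ler_norm (- a)); rewrite normrN in aM2.
  have bM1 := ler_wpM2r M0 (ler_norm b).
  have bM2 := ler_wpM2r M0 (ler_norm (- b)); rewrite normrN in bM2.
  have c1 := ler_norm c.
  have c2 := ler_norm (- c); rewrite normrN in c2.
  have M3 : (- M) ^+ 3 = - M ^+ 3 by ring.
  rewrite !pE M3 sqrrN; apply/andP; split; lra.
pose s := polyrcf.rootsR p.
have sP y : (y \in s) = root p y.
  by rewrite -polyrcf.roots_on_rootsR ?in_itv.
exists (\big[Num.max/x0]_(y <- s) y); split=> [|y py].
  rewrite big_seq; apply: (big_ind (root p)) => // [y z py pz|y].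
    by rewrite /Num.max; case: ifP.
  by rewrite sP.
by apply: le_bigmax_seq; rewrite ?sP.
Qed.

(* Main.v *)
(** A positive eigenvector of a nonnegative matrix belongs to its largest
    eigenvalue.  On a sequential join of regular graphs such an eigenvector can
    be sought among the functions constant on each part, which leaves the
    cubic defining theta in case (1) and a quadratic in cases (2) and (3).
    Removing [k] vertices of the clique next to the isolated vertices leaves
    fewer clique vertices than isolated ones, all of which would have to be
    matched into that clique. *)
Require Import Defs.
From mathcomp Require Import all_boot all_order all_algebra.
From mathcomp Require Import ring lra.
Import Order.TTheory GRing.Theory Num.Theory.
Local Open Scope ring_scope.

(** * Arbitrary graphs: a spectral criterion and an obstruction to matchings *)

(** If [w] is an eigenvector for [mu], the triangle inequality gives [mu * g <= A g] entrywise for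
    [g = |w|]. Pairing with [f] and moving the symmetric [A] onto [f] yields
    [mu * <g, f> <= lambda * <g, f>], where [<g, f>] is positive. The vertex [x0] makes [f] a
    nonzero vector. *)
Lemma spectral_radius_positive_eigenvector (R : rcfType) (G : sgraph)
    (f : G -> R) (lambda : R) (x0 : G) :
  (forall u, 0 < f u) ->
  (forall u, \sum_v (edge u v)%:R * f v = lambda * f u) ->
  is_spectral_radius G lambda.
Proof.
move=> f_gt0 f_eigen.
have sumE (F : G -> R) : \sum_u F u = \sum_(i < #|G|) F (enum_val i).
  by rewrite -big_enum_val; apply: eq_bigl.
split.
  apply/eigenvalueP; exists (\row_i f (enum_val i)).
    apply/rowP => j; rewrite !mxE -f_eigen sumE; apply: eq_bigr => i _.
    by rewrite !mxE edge_sym mulrC.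
  apply/eqP => /rowP/(_ (enum_rank x0)); rewrite !mxE enum_rankK => fx0.
  by have := f_gt0 x0; rewrite fx0 ltxx.
move=> mu /eigenvalueP[w w_eigen w_neq0].
pose g u := `|w 0 (enum_rank u)|.
have g_sub u : mu * g u <= \sum_v (edge v u)%:R * g v.
  have /rowP/(_ (enum_rank u)) := w_eigen; rewrite !mxE => wE.
  apply: le_trans (ler_norm _) _; rewrite normrM normr_id -normrM -wE.
  apply: le_trans (ler_norm_sum _ _ _) _; rewrite sumE; apply: ler_sum => i _.
  by rewrite mxE enum_rankK normrM normr_nat mulrC /g enum_valK.
have gf_gt0 : 0 < \sum_u g u * f u.
  have gf_ge0 u : 0 <= g u * f u by apply: mulr_ge0; [exact: normr_ge0|exact: ltW].
  have [j wj] : exists j, w 0 j != 0 by apply/rV0Pn.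
  rewrite (bigD1 (enum_val j)) //= ltr_wpDr ?sumr_ge0 // mulr_gt0 //.
  by rewrite /g enum_valK normr_gt0.
rewrite -(ler_pM2r gf_gt0) [leRHS]mulr_sumr mulr_sumr.
apply: (@le_trans _ _ (\sum_u (\sum_v (edge v u)%:R * g v) * f u)).
  by apply: ler_sum => u _; rewrite mulrA ler_pM2r.
under eq_bigr do rewrite mulr_suml.
rewrite exchange_big /= le_eqVlt; apply/orP; left; apply/eqP.
apply: eq_bigr => v _; rewrite mulrCA -f_eigen mulr_sumr.
by apply: eq_bigr => u _; rewrite mulrCA mulrA.
Qed.

(** Any [Q] of size [k] inside [S] is a counterexample: the map to matching partners is injective
    and would send [I] into the smaller set [S :\: Q]. *)
Lemma not_factor_critical_barrier (G : sgraph) (k : nat) (S I : {set G}) :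
  [disjoint S & I] -> (forall u v, u \in I -> edge u v -> v \in S) ->
  (k <= #|S| < k + #|I|)%N -> ~ factor_critical k G.
Proof.
move=> dSI nbrI /andP[kS SkI] Gk.
have [Q QS cQ] : exists2 Q : {set G}, Q \subset S & #|Q| = k.
  have : (0 < #|[set Q : {set G} | Q \subset S & #|Q| == k]|)%N.
    by rewrite cards_draws bin_gt0.
  by case/card_gt0P => Q; rewrite inE => /andP[QS /eqP cQ]; exists Q.
have [m [m_sym m_edge m1]] := Gk Q cQ.
have mP x : exists y, m x y.
  have /eqP/cards1P[y my] := m1 x.
  by exists y; have := set11 y; rewrite -my inE.
have m_uniq x y z : m x y -> m x z -> y = z.
  have /eqP/cards1P[t mt] := m1 x => mxy mxz.
  have: y \in [set y | m x y] by rewrite inE.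
  have: z \in [set y | m x y] by rewrite inE.
  by rewrite mt !inE => /eqP-> /eqP->.
pose g x := xchoose (mP x).
have gP x : m x (g x) by apply: xchooseP.
have g_inj : injective g.
  move=> x y gxy; apply: (m_uniq (g x)); first by rewrite m_sym.
  by rewrite gxy m_sym.
pose I' := [set x : remove Q | val x \in I].
have cI' : #|I'| = #|I|.
  have <- : val @: I' = I.
    apply/setP => x; apply/imsetP/idP => [[y]|xI]; first by rewrite inE => yI ->.
    have xQ : x \notin Q.
      by apply: contraTN xI => /(subsetP QS) xS; rewrite (disjointFr dSI xS).
    by exists (Sub x xQ); rewrite ?inE SubK.
  by rewrite card_imset //; apply: val_inj.
have: (#|[set val (g x) | x in I']| <= #|S :\: Q|)%N.
  apply/subset_leq_card/subsetP => _ /imsetP[x xI ->].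
  rewrite !inE (valP (g x)) /=; rewrite inE in xI.
  exact: nbrI xI (m_edge _ _ (gP x)).
rewrite card_imset; last by move=> x y /val_inj /g_inj.
rewrite cI' cardsD (setIidPr QS) cQ leqNgt => /negP; apply.
by rewrite ltn_subLR.
Qed.

(** * Sequential joins of arbitrary length *)

Lemma sum_seqjoin (V : nmodType) (r : nat) (G : 'I_r -> sgraph)
    (F : seqjoin G -> V) :
  \sum_u F u = \sum_i \sum_(x : G i) F (Tagged (fun i => vertex (G i)) x).
Proof.
rewrite (@sig_big_dep _ _ _ _ (fun i => vertex (G i)) xpredT (fun=> xpredT)
  (fun i x => F (Tagged (fun i => vertex (G i)) x))) /=.
by apply: eq_bigr => -[].
Qed.

Lemma card_seqjoin_part (r : nat) (G : 'I_r -> sgraph) (i : 'I_r) :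
  #|[set u : seqjoin G | tag u == i]| = #|G i|.
Proof.
rewrite -sum1_card big_mkcond sum_seqjoin (bigD1 i) //=.
rewrite [X in _ + X]big1 => [|j /negPf ji].
  rewrite addr0 -sum1_card; apply: eq_bigr => x _.
  by rewrite inE /= eqxx.
by apply: big1 => x _; rewrite inE /= ji.
Qed.

(** The parts form an equitable partition, so a positive eigenvector [f] of the quotient matrix
    lifts to one of the join. *)
Lemma spectral_radius_seqjoin (R : rcfType) (r : nat) (G : 'I_r -> sgraph)
    (d : 'I_r -> nat) (f : 'I_r -> R) (lambda : R) (x0 : seqjoin G) :
  (forall i (x : G i), #|[set y | edge x y]| = d i) ->
  (forall i, 0 < f i) ->
  (forall i, (d i)%:R * f i +
     \sum_(j : 'I_r | (i.+1 == j :> nat) || (j.+1 == i :> nat)) #|G j|%:R * f j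
     = lambda * f i) ->
  is_spectral_radius (seqjoin G) lambda.
Proof.
move=> reg f_gt0 f_eigen.
apply: (@spectral_radius_positive_eigenvector _ (seqjoin G)
  (fun u => f (tag u)) _ x0) => //.
move=> [i x] /=; rewrite -f_eigen sum_seqjoin (bigD1 i) //=; congr (_ + _).
  rewrite -mulr_suml -natr_sum -(reg i x) -sum1dep_card.
  rewrite [in RHS]big_mkcond /=.
  congr (_%:R * _); apply: eq_bigr => y _.
  by rewrite /seqjoin_edge /= eqxx tagged_asE /= gtn_eqF // orbF; case: edge.
rewrite [in RHS]big_mkcond [RHS](bigD1 i) //= gtn_eqF //= add0r.
apply: eq_bigr => j; rewrite eq_sym => /negPf ij.
rewrite /seqjoin_edge /= ij /=.
case: ifP => _; last by rewrite big1 // => y _; rewrite mul0r.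
by rewrite sumr_const mul1r mulr_natl.
Qed.

Lemma seqjoin_not_factor_critical (r : nat) (G : 'I_r -> sgraph) (k : nat)
    (i j : 'I_r) :
  i != j -> (forall x y : G i, ~~ edge x y) ->
  (forall l : 'I_r, (i.+1 == l :> nat) || (l.+1 == i :> nat) -> l = j) ->
  (k <= #|G j| < k + #|G i|)%N -> ~ factor_critical k (seqjoin G).
Proof.
move=> ij G0 adj kG.
apply: (@not_factor_critical_barrier _ _ [set u : seqjoin G | tag u == j]
  [set u : seqjoin G | tag u == i]).
- rewrite disjoint_subset; apply/subsetP => u; rewrite !inE => /eqP->.
  by rewrite eq_sym.
- move=> [i' x] [l y]; rewrite !inE /= => /eqP ii'; subst i'.
  rewrite /seqjoin_edge /= => /orP[/andP[/eqP il]|/adj->//].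
  by subst l; rewrite tagged_asE (negPf (G0 _ _)).
- by rewrite !card_seqjoin_part.
Qed.

(** * Joins of cliques with an edgeless graph *)

Lemma complete_degree (m : nat) (x : complete m) :
  #|[set y | edge x y]| = m.-1.
Proof.
transitivity #|[set~ x]|; last by rewrite cardsC1 card_ord.
by apply: eq_card => y; rewrite !inE eq_sym.
Qed.

Lemma edgeless_degree (m : nat) (x : edgeless m) :
  #|[set y | edge x y]| = 0%N.
Proof. by apply/eqP; rewrite cards_eq0; apply/eqP/setP => y; rewrite !inE. Qed.

Lemma spectral_radius_complete_edgeless (R : rcfType) (s t : nat)
    (lambda : R) :
  (0 < s)%N -> 0 < lambda ->
  lambda ^+ 2 = (s%:R - 1) * lambda + s%:R * t%:R ->
  is_spectral_radius (seqjoin2 (complete s) (edgeless t)) lambda.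
Proof.
case: s => // s _ l_gt0 l_root.
have x0 : seqjoin2 (complete s.+1) (edgeless t).
  by exists ord0; apply: (ord0 : 'I_s.+1).
(* These weights solve the equation at the edgeless part identically; the equation at the clique is
   then [l_root]. *)
apply: (@spectral_radius_seqjoin _ _ _
  (fun i => if val i is 0 then s else 0%N)
  (fun i => if val i is 0 then lambda else s.+1%:R)) => //.
- move=> [[|i] lti] /= x; first exact: complete_degree.
  exact: edgeless_degree.
- by move=> [[|i] lti] /=; rewrite ?ltr0Sn.
- move=> [[|[|i]] lti] //=; rewrite big_mkcond !big_ord_recl big_ord0 /= card_ord.
    by rewrite -expr2 l_root -natr1; ring.
  by ring.
Qed.

Lemma spectral_radius_complete_complete_edgeless (R : rcfType) (a b t : nat)
    (lambda : R) :
  (0 < a)%N -> (0 < b)%N -> 0 < lambda -> a%:R - 1 < lambda ->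
  lambda ^+ 3 - (a%:R + b%:R - 2) * lambda ^+ 2
    + ((a%:R - 1) * (b%:R - 1) - a%:R * b%:R - b%:R * t%:R) * lambda
    + b%:R * t%:R * (a%:R - 1) = 0 ->
  is_spectral_radius (seqjoin3 (complete a) (complete b) (edgeless t)) lambda.
Proof.
case: a => // a _; case: b => // b _ l_gt0 l_gta l_root.
have x0 : seqjoin3 (complete a.+1) (complete b.+1) (edgeless t).
  by exists ord0; apply: (ord0 : 'I_a.+1).
(* Here [a] is already the predecessor of the clique size, so [c] is [lambda] minus the degree
   inside the first clique. The weights below solve the equations of both end parts identically. *)
pose c := lambda - a%:R.
have c_gt0 : 0 < c by rewrite /c; move: l_gta; rewrite -natr1; lra.
apply: (@spectral_radius_seqjoin _ _ _
  (fun i => match val i with 0 => a | 1 => b | _ => 0%N end)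
  (fun i => match val i with
            | 0 => b.+1%:R * lambda
            | 1 => lambda * c
            | _ => b.+1%:R * c
            end)) => //.
- move=> [[|[|i]] lti] /= x; [exact: complete_degree..|exact: edgeless_degree].
- by move=> [[|[|i]] lti] /=; rewrite mulr_gt0 ?ltr0Sn.
- move=> [[|[|[|i]]] lti] //=;
    rewrite big_mkcond !big_ord_recl big_ord0 /= !card_ord /c.
  + by ring.
  (* At the middle part, right side minus left side is exactly the cubic. *)
  + by apply/eqP; rewrite -subr_eq0 -oppr_eq0 -[X in _ == X]l_root; apply/eqP;
      rewrite -!natr1; ring.
  + by ring.
Qed.

(** * Lower bounds for the largest root of the cubic *)

Lemma theta_polyE (R : rcfType) (n k : nat) (x : R) :
  (theta_poly R n k).[x] = x ^+ 3 - (n%:R - 4) * x ^+ 2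
    - (n%:R + 2 * k%:R - 1) * x + 2 * (k%:R + 1) * (n%:R - k%:R - 4).
Proof. by rewrite /theta_poly !(hornerE, hornerXn). Qed.

(** The cubic changes sign between [m] and [n + 2k], so it has a root beyond [m]. *)
Lemma theta_gt (R : rcfType) (n k : nat) (theta m : R) :
  is_theta n k theta -> (k + 4 <= n)%N -> m <= n%:R + 2 * k%:R ->
  (theta_poly R n k).[m] < 0 -> m < theta.
Proof.
move=> [_ theta_max] nk mM pm.
have [x /andP[mx _] px] : exists2 x, m <= x <= n%:R + 2 * k%:R
    & root (theta_poly R n k) x.
  apply: poly_ivt => //; rewrite ltW //= theta_polyE.
  have k_ge0 : 0 <= k%:R :> R by [].
  have n_ge : k%:R + 4 <= n%:R :> R by rewrite -natrD ler_nat.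
  (* This endpoint makes the linear coefficient [1 - x], and the nonconstant terms collapse to a
     visibly nonnegative expression. *)
  set x := n%:R + 2 * k%:R.
  have x_ge1 : 1 <= x by rewrite /x; lra.
  have xx : x <= x ^+ 2 by nra.
  have -> : x ^+ 3 - (n%:R - 4) * x ^+ 2 - (x - 1) * x
    = (2 * k%:R + 3) * x ^+ 2 + x by rewrite /x; ring.
  by rewrite addr_ge0 ?mulr_ge0 //; nra.
apply: lt_le_trans (theta_max _ px); rewrite lt_neqAle mx andbT.
by apply: contraTneq px => <-; rewrite /root lt_eqF.
Qed.

Theorem theorem4p1 (R : rcfType) (k n : nat) (theta : R)
    (n_eq_k : n = k %[mod 2])
    (theta_def : is_theta n k theta) :
  [/\ ((k + 4 <= n)%N /\ n \notin [:: k + 6; k + 8]%N \/ (k, n) = (0, 8)%N) ->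
        let G := seqjoin3 (complete (n - k - 3)) (complete (k + 1))
                   (edgeless 2) in
        is_spectral_radius G theta /\ ~ factor_critical k G,
      n = (k + 6)%N ->
        let G := seqjoin2 (complete (k + 2)) (edgeless 4) in
        is_spectral_radius G
          ((k%:R + 1 + Num.sqrt (k%:R ^+ 2 + 18 * k%:R + 33)) / 2 : R)
        /\ ~ factor_critical k G
    & n = (k + 8)%N ->
        let G := seqjoin2 (complete (k + 3)) (edgeless 5) in
        is_spectral_radius G
          ((k%:R + 2 + Num.sqrt (k%:R ^+ 2 + 24 * k%:R + 64)) / 2 : R)
        /\ ~ factor_critical k G].
Proof.
have k_ge0 : 0 <= k%:R :> R by [].
split=> [n_cond|_|_] G.
- have nk : (k + 4 <= n)%N by case: n_cond => [[]//|[-> ->]].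
  have n_ge : k%:R + 4 <= n%:R :> R by rewrite -natrD ler_nat.
  have aE : (n - k - 3)%:R = n%:R - k%:R - 3 :> R.
    by rewrite -subnDA natrB ?natrD; [ring|apply: leq_trans nk; rewrite leq_add2l].
  split.
    have theta_root : (theta_poly R n k).[theta] = 0 by apply/rootP/theta_def.1.
    (* These two bounds make the weights of the eigenvector positive; [n - k - 4] is the degree
       inside the first clique. *)
    have [theta_gt0 theta_gta] : 0 < theta /\ n%:R - k%:R - 4 < theta.
      have [n_eq|n_neq] := eqVneq n (k + 4)%N.
        (* The test point [n - k - 4 = 0] used otherwise is a root here. *)
        have theta_gtk : k%:R + 1 < theta.
          apply: (theta_gt _ _ _ _ _ theta_def) => //; first lra.
          (* For [n = k + 4] the cubic is [x (x^2 - k x - 3 (k + 1))], with value [-2 (k + 1)^2] at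
             [k + 1]. *)
          by rewrite theta_polyE n_eq natrD; nra.
        by rewrite n_eq natrD; split; lra.
      have n_gt : k%:R + 5 <= n%:R :> R.
        by rewrite -natrD ler_nat addnS ltn_neqAle eq_sym n_neq.
      have theta_gta : n%:R - k%:R - 4 < theta.
        apply: (theta_gt _ _ _ _ _ theta_def) => //; first lra.
        have -> : (theta_poly R n k).[n%:R - k%:R - 4]
          = - ((n%:R - k%:R - 3) * (k%:R + 1) * (n%:R - k%:R - 4)).
          by rewrite theta_polyE; ring.
        by rewrite oppr_lt0 !mulr_gt0 //; lra.
      by split; lra.
    apply: spectral_radius_complete_complete_edgeless => //.
    + by rewrite -subnDA subn_gt0; apply: leq_trans nk; rewrite -addnS.
    + by rewrite addn1.
    + by rewrite aE; lra.
    + by rewrite -theta_root theta_polyE aE natrD; ring.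
  (* The two isolated vertices see only the middle clique, and [k + 1 < k + 2]. *)
  apply: (@seqjoin_not_factor_critical _ _ _ (Ordinal (isT : 2 < 3)%N)
    (Ordinal (isT : 1 < 3)%N)) => //.
    by move=> [[|[|[|l]]] ltl] //= _; apply: val_inj.
  by rewrite /= !card_ord leq_addr ltn_add2l.
- split.
    apply: spectral_radius_complete_edgeless.
    + by rewrite addn2.
    + by rewrite divr_gt0 // ltr_wpDr ?sqrtr_ge0 // ltr_wpDl.
    (* The radicand is the discriminant [(k + 1)^2 + 16 (k + 2)] of the quadratic for [s = k + 2],
       [t = 4]. *)
    + set q := Num.sqrt _; have q2 : q ^+ 2 = k%:R ^+ 2 + 18 * k%:R + 33.
        by rewrite sqr_sqrtr // !addr_ge0 ?sqr_ge0 ?mulr_ge0.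
      by rewrite natrD expr_div_n sqrrD q2; field.
  apply: (@seqjoin_not_factor_critical _ _ _ (Ordinal (isT : 1 < 2)%N)
    (Ordinal (isT : 0 < 2)%N)) => //.
    by move=> [[|[|l]] ltl] //= _; apply: val_inj.
  by rewrite /= !card_ord leq_addr ltn_add2l.
- split.
    apply: spectral_radius_complete_edgeless.
    + by rewrite addn3.
    + by rewrite divr_gt0 // ltr_wpDr ?sqrtr_ge0 // ltr_wpDl.
    (* Likewise [(k + 2)^2 + 20 (k + 3)] for [s = k + 3], [t = 5]. *)
    + set q := Num.sqrt _; have q2 : q ^+ 2 = k%:R ^+ 2 + 24 * k%:R + 64.
        by rewrite sqr_sqrtr // !addr_ge0 ?sqr_ge0 ?mulr_ge0.
      by rewrite natrD expr_div_n sqrrD q2; field.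
  apply: (@seqjoin_not_factor_critical _ _ _ (Ordinal (isT : 1 < 2)%N)
    (Ordinal (isT : 0 < 2)%N)) => //.
    by move=> [[|[|l]] ltl] //= _; apply: val_inj.
  by rewrite /= !card_ord leq_addr ltn_add2l.
Qed.
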